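(* Let $F$ be a field of characteristic not two and let $E$ be a finite-dimensional vector space over $F$ with an arbitrary symmetric bilinear form $(U,V)\mapsto U\cdot V$. If $U,V,W\in E$ are three distinct points, then the line $UW$ is perpendicular to the line $VW$ if and only if the quadrances $Q_W=Q(U,V)$, $Q_U=Q(V,W)$ and $Q_V=Q(U,W)$ satisfy $$Q_W=Q_U+Q_V.$$
   Context: Elements of $E$ are called points or vectors. The quadrance between points $U$ and $V$ is $Q(U,V)=(V-U)\cdot(V-U)$. For distinct points $U,V$, $UV$ denotes the affine line through them. The line $UV$ is perpendicular to the line $WZ$ precisely when $(V-U)\cdot(Z-W)=0$. The bilinear form is not assumed non-degenerate. *)

(* Defs.v *)
From HB Require Import structures.
From mathcomp Require Import all_boot all_order all_algebra.

Set Implicit Arguments.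
Unset Strict Implicit.
Unset Printing Implicit Defensive.

Import GRing.Theory.
Local Open Scope ring_scope.

Definition quadrance (F : fieldType) (E : vectType F) (dot : {symmetric E})
    (U V : E) : F :=
  dot (V - U) (V - U).

(* The affine line through U and V, as a set of points; it is a genuine line
   only when U != V. *)
Definition line (F : fieldType) (E : vectType F) (U V : E) : {pred E} :=
  [pred P | P - U \in <[V - U]>%VS].

(* A relation between lines as point sets: l and m are perpendicular when they
   are UV and WZ for pairs of distinct points with (V - U) . (Z - W) = 0. Two
   pairs of distinct points spanning the same line have proportional nonzero
   differences, so the choice of points is immaterial. *)
Definition perpendicular (F : fieldType) (E : vectType F)
    (dot : {symmetric E}) (l m : {pred E}) : Prop :=
  exists U V W Z : E,
    [/\ U != V, W != Z, l =i line U V, m =i line W Z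
      & dot (V - U) (Z - W) = 0].

(* Main.v *)
Require Import Defs.
From mathcomp Require Import all_boot all_order all_algebra.

Set Implicit Arguments.
Unset Strict Implicit.
Unset Printing Implicit Defensive.

Import GRing.Theory.
Local Open Scope ring_scope.

(** Put a = W - U and b = W - V, so that V - U = a - b. Expanding the square
    gives Q(U,V) = Q(U,W) + Q(V,W) - 2 (a . b) ([quadrance_polarization]), and
    since 2 is invertible the Pythagorean equation says exactly that
    a . b = 0. What remains is that perpendicularity, defined on point sets,
    can be tested on the pairs of points given: all the differences of points
    of a line are multiples of one direction vector ([line_sub]), so the
    vanishing of the form does not depend on the points chosen
    ([perpendicular_lineE]). *)

Lemma line_left (F : fieldType) (E : vectType F) (U V : E) : U \in line U V.
Proof. by rewrite inE subrr mem0v. Qed.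

Lemma line_right (F : fieldType) (E : vectType F) (U V : E) : V \in line U V.
Proof. by rewrite inE memv_line. Qed.

Lemma line_sub (F : fieldType) (E : vectType F) (P Q A B : E) :
  A \in line P Q -> B \in line P Q -> exists k, B - A = k *: (Q - P).
Proof.
rewrite !inE => inA inB; apply/vlineP.
by rewrite -(subrKA P) -(opprB A) memvB.
Qed.

(** Lets perpendicularity be tested on any pairs of distinct points spanning
    the lines: other choices have proportional differences, and the form is
    bilinear. *)
Lemma perpendicular_lineE (F : fieldType) (E : vectType F)
    (dot : {symmetric E}) (A B C D : E) :
  A != B -> C != D ->
  perpendicular dot (line A B) (line C D) <-> dot (B - A) (D - C) = 0.
Proof.
move=> neqAB neqCD; split=> [[P [Q [R [S]]]] | dot0]; last by exists A, B, C, D.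
case=> _ _ eqAB eqCD dot0.
have [|| k ->] := @line_sub _ _ P Q A B; rewrite -?eqAB ?line_left ?line_right //.
have [|| l ->] := @line_sub _ _ R S C D; rewrite -?eqCD ?line_left ?line_right //.
by rewrite linearZl_LR linearZr_LR /= dot0 !mulr0.
Qed.

(** The law of cosines at W. *)
Lemma quadrance_polarization (F : fieldType) (E : vectType F)
    (dot : {symmetric E}) (U V W : E) :
  quadrance dot U V =
    quadrance dot V W + quadrance dot U W - dot (W - U) (W - V) *+ 2.
Proof.
rewrite /quadrance; have -> : V - U = (W - U) - (W - V) by rewrite opprB [RHS]addrC subrKA.
rewrite hnormB expr0 mul1r mulr2n.
by rewrite [dot (W - U) (W - U) + _]addrC.
Qed.

Theorem theorem2 (F : fieldType) (charF : 2%N \notin [pchar F])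
    (E : vectType F) (dot : {symmetric E}) (U V W : E)
    (neqUV : U != V) (neqVW : V != W) (neqUW : U != W) :
  perpendicular dot (line U W) (line V W) <->
  quadrance dot U V = quadrance dot V W + quadrance dot U W.
Proof.
apply: (iff_trans (perpendicular_lineE dot neqUW neqVW)).
rewrite (quadrance_polarization dot U V W).
have two_neq0 : 2%:R != 0 :> F by rewrite inE /= in charF.
split=> [-> | /eqP]; first by rewrite mul0rn subr0.
rewrite -subr_eq0 addrAC subrr sub0r oppr_eq0 -mulr_natr mulf_eq0.
by rewrite (negPf two_neq0) orbF => /eqP.
Qed.
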